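(* Let $V$ be a finite-dimensional Euclidean space and let $K \subseteq V$ be a proper, self-dual cone satisfying the following assumption: for any $v, w \in \mathrm{int}(K)$ there exists a self-adjoint mapping $D\in L(V)$, acting diffusively on $K$, with $Dv = w$. Let $A \in L(V)$ be quasi-monotone (QM) with respect to $K$ and stable. Then there exists a symmetric (self-adjoint) $D \succ 0$ in $L(V)$ that acts diffusively on $K$ with $A^*D + DA \prec 0$.
   Context: $V$ is a finite-dimensional real vector space with inner product $\langle \cdot,\cdot\rangle$; $L(V)$ is the space of linear mappings from $V$ to $V$; $A^*$ is the adjoint of $A$. For self-adjoint $P$, $P\succ 0$ means positive definite and $P\prec 0$ means negative definite. A convex cone is a subset $K\subseteq V$ with $\alpha x+\beta y\in K$ for all $x,y\in K$ and $\alpha,\beta>0$. A proper cone is a convex cone that is closed, pointed ($K\cap(-K)=\{0\}$) and generating ($V=K-K$). $K$ is self-dual if $K=K^*$, where $K^*=\{y\in V:\langle x,y\rangle\ge 0 \text{ for all } x\in K\}$. $\mathrm{int}(K)$ is the interior of $K$. $T\in L(V)$ is quasi-monotone (QM) with respect to $K$ if $x,y\in K$ and $\langle x,y\rangle=0$ imply $\langle x,Ty\rangle\ge 0$. $D\in L(V)$ acts diffusively on (with respect to) $K$ if $D(K)\subseteq K$, and $x,y\in K$ with $\langle x,y\rangle=0$ implies $\langle x,Dy\rangle=0$. $T\in L(V)$ is stable if all eigenvalues (real or complex) of $T$ have negative real part. *)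

(* Defs.v *)
From HB Require Import structures.
From mathcomp Require Import all_boot all_order all_algebra.
From mathcomp Require Import sesquilinear complex.
From mathcomp Require Import all_classical all_reals all_analysis.

Set Implicit Arguments.
Unset Strict Implicit.
Unset Printing Implicit Defensive.

Import Order.TTheory GRing.Theory Num.Theory.
Import numFieldNormedType.Exports.

Local Open Scope classical_set_scope.
Local Open Scope ring_scope.

#[short(type="normedVectType")]
HB.structure Definition NormedVector (R : numFieldType) :=
  {V of NormedModule R V & Vector R V}.

(* [normedVectType R] only provides the topology and the finite dimension: a
   Euclidean space is such a [V] whose norm is the one induced by [ip]. *)
Definition euclidean (R : realType) (V : normedVectType R)
    (ip : {dot V for idfun}) : Prop :=
  forall x : V, `|x| = Num.sqrt (ip x x).

Section InnerProduct.
Context {R : realType} {V : vectType R} (ip : {dot V for idfun}).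

(* By [adjointP] and [adjoint_uniq] the default value [0] is never used. *)
Definition adjoint (A : 'End(V)) : 'End(V) :=
  xget 0 [set B : 'End(V) | forall x y, ip (A x) y = ip x (B y)].

Let riesz_fun (y : V) : 'Hom(V, R^o) := linfun (applyr ip y : V -> R^o).

Let riesz_funE x y : riesz_fun y x = ip x y.
Proof. by rewrite lfunE. Qed.

Let riesz_fun_linear : linear riesz_fun.
Proof.
move=> a u v; apply/lfunP => x.
by rewrite add_lfunE scale_lfunE !riesz_funE linearPr.
Qed.

Let riesz_mixin := GRing.isSemilinear.Build R _ _ _ riesz_fun
  (GRing.semilinear_linear riesz_fun_linear).

Let riesz_lin : {linear V -> 'Hom(V, R^o)} := HB.pack riesz_fun riesz_mixin.

Let riesz : 'Hom(V, 'Hom(V, R^o)) := linfun riesz_lin.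

Let rieszE x y : riesz y x = ip x y.
Proof. by rewrite lfunE /= riesz_funE. Qed.

Let lker_riesz : lker riesz == 0%VS.
Proof.
rewrite -subv0; apply/subvP => y; rewrite memv_ker memv0 => /eqP ry0.
apply: contraT => /(@neq0_dnorm_gt0 _ _ _ ip).
by rewrite -rieszE ry0 zero_lfunE ltxx.
Qed.

Let limg_riesz : limg riesz = fullv.
Proof.
apply/eqP; rewrite eqEdim subvf.
have -> : \dim (limg riesz) = \dim {:V}.
  by rewrite -[RHS](limg_ker_dim riesz) (eqP lker_riesz) capv0 dimv0.
by rewrite !dimvf /dim /= muln1.
Qed.

Lemma adjointP (A : 'End(V)) x y : ip (A x) y = ip x (adjoint A y).
Proof.
rewrite /adjoint; case: xgetP => [B _ -> // | noB]; exfalso.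
pose Af y' : 'Hom(V, R^o) := (riesz y' \o A)%VF.
pose B y' := (riesz^-1)%VF (Af y').
have B_lin : linear B.
  move=> a u v; rewrite /B -linearP; congr (_ _).
  apply/lfunP => x'.
  by rewrite add_lfunE scale_lfunE !comp_lfunE !rieszE linearPr.
pose mB := GRing.isSemilinear.Build R _ _ _ B (GRing.semilinear_linear B_lin).
pose LB : {linear V -> V} := HB.pack B mB.
apply: (noB (linfun LB)) => x' y'; rewrite lfunE /= /B -[RHS]rieszE.
by rewrite limg_lfunVK ?limg_riesz ?memvf// comp_lfunE rieszE.
Qed.

Lemma adjoint_uniq (A B : 'End(V)) :
  (forall x y, ip (A x) y = ip x (B y)) -> B = adjoint A.
Proof.
move=> AB; apply/lfunP => y; apply/eqP; rewrite -subr_eq0; apply: contraT.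
move=> /(@neq0_dnorm_gt0 _ _ _ ip); set z := _ - _.
have -> : ip z z = ip z (B y) - ip z (adjoint A y) by rewrite -linearBr.
by rewrite -AB adjointP subrr ltxx.
Qed.

Definition self_adjoint (A : 'End(V)) : Prop := adjoint A = A.

Definition posdef (P : 'End(V)) : Prop :=
  self_adjoint P /\ (forall x : V, x != 0 -> 0 < ip x (P x)).

Definition negdef (P : 'End(V)) : Prop :=
  self_adjoint P /\ (forall x : V, x != 0 -> ip x (P x) < 0).

Definition dual_cone (K : set V) : set V :=
  [set y | forall x, K x -> 0 <= ip x y].

Definition self_dual (K : set V) : Prop := K = dual_cone K.

Definition quasi_monotone (K : set V) (T : 'End(V)) : Prop :=
  forall x y, K x -> K y -> ip x y = 0 -> 0 <= ip x (T y).

Definition diffusive (K : set V) (D : 'End(V)) : Prop :=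
  D @` K `<=` K /\ (forall x y, K x -> K y -> ip x y = 0 -> ip x (D y) = 0).

End InnerProduct.

Definition convex_cone (R : realType) (V : vectType R) (K : set V) : Prop :=
  forall (x y : V) (a b : R), K x -> K y -> 0 < a -> 0 < b ->
    K (a *: x + b *: y).

Definition proper_cone (R : realType) (V : normedVectType R) (K : set V) :
    Prop :=
  [/\ convex_cone K,
      closed K,
      K `&` [set - x | x in K] = [set 0] &
      [set x - y | x in K & y in K] = [set: V]].

(* The complex eigenvalues of [T] are those of its matrix in a basis of [V],
   viewed as a complex matrix; the spectrum does not depend on the basis. *)
Definition stable (R : realType) (V : vectType R) (T : 'End(V)) : Prop :=
  forall l : R[i],
    eigenvalue (map_mx (real_complex R)
      (passmx.mxof (vbasis {:V}) (vbasis {:V}) T)) l ->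
    complex.Re l < 0.

(* Main.v *)
Require Import Defs.
From HB Require Import structures.
From mathcomp Require Import all_boot all_order all_algebra.
From mathcomp Require Import sesquilinear complex ring lra.
From mathcomp Require Import all_classical all_reals all_analysis.

Set Implicit Arguments.
Unset Strict Implicit.
Unset Printing Implicit Defensive.

Import Order.TTheory GRing.Theory Num.Theory.
Import numFieldNormedType.Exports.

Local Open Scope classical_set_scope.
Local Open Scope ring_scope.

(** A quasi-monotone map without eigenvalues in [[0, +oo[] sends some interior
    point of [K] into the opposite of the interior.  Applied to [A] and to its
    adjoint, this gives interior points [v] and [w] with [- A v] and [- A^* w]
    interior; take [D] self-adjoint and diffusive with [D v = w].  Then
    [T := A^* D + D A] and [- D] are both self-adjoint and quasi-monotone, and
    send [v] into the opposite of the interior.  A self-adjoint map with these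
    properties is negative definite, since its largest eigenvalue has an
    eigenvector in [K]. *)

(** * Inner product and topology of a finite-dimensional Euclidean space *)

Section EuclideanSpace.
Import passmx.
Context {R : realType} {V : normedVectType R} (ip : {dot V for idfun}).
Implicit Types (x y z : V) (a : R) (A B T : 'End(V)).

Lemma ipC x y : ip x y = ip y x.
Proof. by rewrite hermC expr0 mul1r. Qed.

Lemma ipDl x y z : ip (x + y) z = ip x z + ip y z.
Proof. exact: linearDl. Qed.

Lemma ipDr x y z : ip x (y + z) = ip x y + ip x z.
Proof. exact: linearDr. Qed.

Lemma ipNl x y : ip (- x) y = - ip x y.
Proof. exact: linearNl. Qed.

Lemma ipNr x y : ip x (- y) = - ip x y.
Proof. exact: linearNr. Qed.

Lemma ipZl a x y : ip (a *: x) y = a * ip x y.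
Proof. exact: linearZl_LR. Qed.

Lemma ipZr a x y : ip x (a *: y) = a * ip x y.
Proof. by rewrite ipC ipZl ipC. Qed.

Lemma ip0l x : ip 0 x = 0.
Proof. exact: linear0l. Qed.

Lemma ip0r x : ip x 0 = 0.
Proof. exact: linear0r. Qed.

Definition ipE := (ipDl, ipDr, ipNl, ipNr, ipZl, ipZr).

Lemma ip_gt0 x : x != 0 -> 0 < ip x x.
Proof. exact: neq0_dnorm_gt0. Qed.

Lemma adjointPr A x y : ip x (A y) = ip (adjoint ip A x) y.
Proof. by rewrite ipC adjointP ipC. Qed.

Lemma self_adjointP T :
  self_adjoint ip T <-> forall x y, ip (T x) y = ip x (T y).
Proof.
split=> [Tsa x y|Tsa]; first by rewrite adjointP Tsa.
exact/esym/adjoint_uniq.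
Qed.

Hypothesis euc : euclidean ip.

Lemma sqr_normE x : `|x| ^+ 2 = ip x x.
Proof.
rewrite euc sqr_sqrtr//; have [->|/ip_gt0/ltW//] := eqVneq x 0.
by rewrite ip0l.
Qed.

(** Polarization reduces continuity of [ip] to continuity of the norm. *)
Lemma ip_polar x y : ip x y = 4^-1 * (`|x + y| ^+ 2 - `|x - y| ^+ 2).
Proof. by rewrite !sqr_normE !ipE (ipC y x); field. Qed.

(** Cauchy-Schwarz, read off from the squared triangle inequality. *)
Lemma ip_le_norm x y : ip x y <= `|x| * `|y|.
Proof.
have: `|x + y| ^+ 2 <= (`|x| + `|y|) ^+ 2.
  by rewrite ler_sqr ?nnegrE ?addr_ge0// ler_normD.
by rewrite sqrrD !sqr_normE !ipE (ipC y x); lra.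
Qed.

Lemma norm_ip_le x y : `|ip x y| <= `|x| * `|y|.
Proof.
by rewrite ler_norml ip_le_norm andbT lerNl -ipNl -(normrN x) ip_le_norm.
Qed.

Let e := vbasis {:V}.
Let e_basis : basis_of {:V} e := vbasisP {:V}.

(** Ties the topology of [V] to coordinates: boundedness of linear maps and Heine-Borel both rest on
    it. *)
Lemma coord_bounded :
  exists2 C : R, 0 <= C & forall i x, `|coord e i x| <= C * `|x|.
Proof.
have ei0 (i : 'I_(\dim {:V})) : e`_i != 0.
  apply: (free_not0 (basis_free e_basis)).
  by apply: mem_nth; rewrite size_tuple.
(* the coordinate functional is represented by the adjoint of a rank one map *)
pose E i : 'End(V) := linfun (fun x => coord e i x *: e`_i).
have Ei i x : coord e i x = ip x (adjoint ip (E i) e`_i) / ip e`_i e`_i.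
  have El : linear (fun x => coord e i x *: e`_i).
    by move=> b u v; rewrite linearP/= scalerDl scalerA.
  pose F : {linear V -> V} :=
    HB.pack (fun x => coord e i x *: e`_i)
      (GRing.isSemilinear.Build R _ _ _ _ (GRing.semilinear_linear El)).
  have EF : E i = linfun F by [].
  by rewrite -adjointP EF lfunE/= ipZl mulfK// gt_eqF// ip_gt0.
pose c i := `|adjoint ip (E i) e`_i| / ip e`_i e`_i.
have c_ge0 i : 0 <= c i by rewrite divr_ge0// ltW// ip_gt0.
exists (\sum_i c i) => [|i x]; first exact: sumr_ge0.
apply: (@le_trans _ _ (c i * `|x|)); last first.
  by rewrite ler_wpM2r// (bigD1 i)//= lerDl sumr_ge0.
rewrite Ei normrM normfV (gtr0_norm (ip_gt0 (ei0 i))) /c mulrAC.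
by rewrite ler_wpM2r ?invr_ge0 ?(ltW (ip_gt0 _))// mulrC norm_ip_le.
Qed.

Lemma lfun_bounded A : exists2 C : R, 0 <= C & forall x, `|A x| <= C * `|x|.
Proof.
have [C C0 coordC] := coord_bounded.
exists (\sum_(i < \dim {:V}) C * `|A e`_i|) => [|x].
  by apply: sumr_ge0 => i _; rewrite mulr_ge0.
rewrite {1}(coord_basis e_basis (memvf x)) linear_sum mulr_suml.
apply: (le_trans (ler_norm_sum _ _ _)); apply: ler_sum => i _.
by rewrite linearZ/= normrZ mulrAC ler_wpM2r.
Qed.

Lemma lfun_continuous A : continuous A.
Proof.
have [C C0 AC] := lfun_bounded A.
apply: bounded_linear_continuous; apply/bounded_funP => r; exists (C * r) => x.
by move=> xr; rewrite (le_trans (AC x))// ler_wpM2l.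
Qed.

Lemma vecof_continuous : continuous (vecof e).
Proof.
apply: bounded_linear_continuous; apply/bounded_funP => r.
exists (\sum_(i < \dim {:V}) r * `|e`_i|) => x xr.
apply: (le_trans (ler_norm_sum _ _ _)); apply: ler_sum => i _.
rewrite normrZ ler_wpM2r// (le_trans _ xr)//.
rewrite [leRHS]/Num.norm/= mx_normrE.
by apply/bigmax_geP; right => /=; exists (0, i).
Qed.

Lemma closed_bounded_compact (S : set V) (M : R) :
  closed S -> (forall x, S x -> `|x| <= M) -> compact S.
Proof.
move=> Scl SM; have [C C0 coordC] := coord_bounded.
have -> : S = vecof e @` (vecof e @^-1` S).
  rewrite eqEsubset; split=> [x Sx|_ [v Sv <-]//].
  by exists (rVof e x); rewrite /= rVofK.
apply: continuous_compact; first exact/continuous_subspaceT/vecof_continuous.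
apply: bounded_closed_compact; last first.
  by apply: closed_comp => // x _; exact: vecof_continuous.
exists (C * M); split=> [|N /ltW CMN v Sv]; first exact: num_real.
apply: le_trans CMN.
rewrite [leLHS]/Num.norm/= mx_normrE; apply/bigmax_leP; split=> [|[i j] _ /=].
  by rewrite mulr_ge0// (le_trans _ (SM _ Sv)).
rewrite ord1 -[v](vecofK e_basis) -coord_rVof.
by rewrite (le_trans (coordC _ _))// ler_wpM2l// SM.
Qed.

Lemma continuous_ip (f g : V -> V) :
  continuous f -> continuous g -> continuous (fun x => ip (f x) (g x)).
Proof.
move=> fc gc x; have -> : (fun x => ip (f x) (g x)) = fun x =>
    4^-1 * (`|f x + g x| * `|f x + g x| - `|f x - g x| * `|f x - g x|).
  by apply/funext => z; rewrite ip_polar.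
have fgD : `|f y + g y| @[y --> x] --> `|f x + g x|.
  by apply: cvg_norm; apply: cvgD; [exact: fc|exact: gc].
have fgB : `|f y - g y| @[y --> x] --> `|f x - g x|.
  by apply: cvg_norm; apply: cvgB; [exact: fc|exact: gc].
by apply: cvgM; [exact: cvg_cst|apply: cvgB; exact: cvgM].
Qed.

End EuclideanSpace.

(** * Self-dual cones: interior points and the Moreau decomposition *)

Section SelfDualCone.
Context {R : realType} {V : normedVectType R} (ip : {dot V for idfun}).
Variable K : set V.
Hypotheses (euc : euclidean ip) (K_closed : closed K) (K_sd : self_dual ip K).
Implicit Types (x y z u v : V) (A T : 'End(V)).

Lemma self_dualP z : K z <-> forall y, K y -> 0 <= ip y z.
Proof. by have -> : K z = dual_cone ip K z by rewrite -K_sd. Qed.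

Lemma cone_ip_ge0 y z : K y -> K z -> 0 <= ip y z.
Proof. by move=> Ky /self_dualP; exact. Qed.

Lemma cone0 : K 0.
Proof. by apply/self_dualP => y _; rewrite ip0r. Qed.

Lemma coneD x y : K x -> K y -> K (x + y).
Proof.
by move=> Kx Ky; apply/self_dualP => z Kz; rewrite ipDr addr_ge0// cone_ip_ge0.
Qed.

Lemma coneZ (a : R) x : 0 <= a -> K x -> K (a *: x).
Proof.
by move=> a0 Kx; apply/self_dualP => z Kz; rewrite ipZr mulr_ge0// cone_ip_ge0.
Qed.

Lemma cone_sphere_min (f : V -> R) : continuous f ->
  (exists2 y, K y & y != 0) ->
  exists y, [/\ K y, `|y| = 1 & forall z, K z -> `|z| = 1 -> f y <= f z].
Proof.
move=> fc [y Ky y0]; pose S := K `&` [set x | `|x| = 1].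
have S_closed : closed S.
  apply: closedI => //.
  apply: (@preimage_closed _ _ (fun x : V => `|x|) [set 1]).
    by move=> x _; exact: norm_continuous.
  exact: closed_eq.
have S_compact : compact S.
  by apply: (closed_bounded_compact euc S_closed (M := 1)) => x [_ /= ->].
have [|u /set_mem[Ku u1] umin] := compact_EVT_min _ S_compact
    (@continuous_subspaceT _ _ S _ fc).
  exists (`|y|^-1 *: y); split; first by apply: coneZ; rewrite ?invr_ge0.
  by rewrite /= normrZ normfV normr_id mulVf// normr_eq0.
by exists u; split=> // z Kz z1; apply: umin; exact/mem_set.
Qed.

(** Moving an interior [u] slightly along [- y] stays in [K], which forces strict positivity.
    Conversely, the minimum of [ip y u] over unit [y] in [K] is a valid radius: by Cauchy-Schwarz,
    smaller perturbations of [u] keep all pairings nonnegative. *)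
Lemma interior_coneP u :
  interior K u <-> forall y, K y -> y != 0 -> 0 < ip y u.
Proof.
split=> [/nbhs_ballP[e /= e0 uK] y Ky y0|upos].
  have ny0 : 0 < `|y| by rewrite normr_gt0.
  pose a := e / 2 / `|y|; have a0 : 0 < a by rewrite !divr_gt0.
  have /uK Kz : ball u e (u - a *: y).
    rewrite -ball_normE /ball_/= opprB addrC subrK normrZ gtr0_norm//.
    by rewrite divfK ?gt_eqF// ltr_pdivrMr// ltr_pMr// ltr1n.
  have := cone_ip_ge0 Ky Kz; rewrite !ipE subr_ge0; apply: lt_le_trans.
  by rewrite mulr_gt0// ip_gt0.
(* Without a nonzero vector in [K] there is no unit vector to minimize over, but then every [z] lies
   in the dual cone. *)
have [Kn0|K0] := pselect (exists2 y, K y & y != 0); last first.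
  apply/nbhs_ballP; exists 1 => //= z _; apply/self_dualP => y Ky.
  have [->|y0] := eqVneq y 0; first by rewrite ip0l.
  by exfalso; apply: K0; exists y.
have fc : continuous (fun y => ip y u).
  by apply: (continuous_ip euc (f := id) (g := cst u)) => x;
    [exact: cvg_id|exact: cvg_cst].
have [y [Ky y1 ymin]] := cone_sphere_min fc Kn0.
have y0 : y != 0 by rewrite -normr_eq0 y1 oner_eq0.
have m0 := upos _ Ky y0.
apply/nbhs_ballP; exists (ip y u) => //= z; rewrite -ball_normE /ball_/= => uz.
apply/self_dualP => x Kx; have [->|x0] := eqVneq x 0; first by rewrite ip0l.
have nx0 : 0 < `|x| by rewrite normr_gt0.
have : ip y u <= ip (`|x|^-1 *: x) u.
  apply: ymin; first by apply: coneZ; rewrite ?invr_ge0.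
  by rewrite normrZ normfV normr_id mulVf// gt_eqF.
rewrite ipZl ler_pdivlMl// => xu.
have := ip_le_norm euc x (u - z); rewrite !ipE => xuz.
have : `|x| * `|u - z| <= `|x| * ip y u by rewrite ler_wpM2l// ltW.
by move: xu xuz; lra.
Qed.

Lemma interior_coneD u v : interior K u -> K v -> interior K (u + v).
Proof.
move=> /interior_coneP uK Kv; apply/interior_coneP => y Ky y0.
by rewrite ipDr ltr_pwDl ?uK// cone_ip_ge0.
Qed.

(** Each basis vector is a difference of two points of [K]; add up all these points. A [y] in [K]
    orthogonal to the sum is orthogonal to every summand, hence to the basis. *)
Lemma interior_cone_neq0 :
  [set x - y | x in K & y in K] = [set: V] -> exists u, interior K u.
Proof.
move=> K_gen; pose e := vbasis {:V}.
have /choice[p pP] (i : 'I_(\dim {:V})) :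
    exists p : V * V, [/\ K p.1, K p.2 & e`_i = p.1 - p.2].
  have : [set: V] e`_i by [].
  by rewrite -K_gen => -[x Kx [y Ky xy]]; exists (x, y).
exists (\sum_i ((p i).1 + (p i).2)); apply/interior_coneP => y Ky y0.
have ipp i : 0 <= ip y ((p i).1 + (p i).2).
  by have [K1 K2 _] := pP i; apply: cone_ip_ge0 => //; exact: coneD.
have ip_sum (F : 'I_(\dim {:V}) -> V) : ip y (\sum_i F i) = \sum_i ip y (F i).
  by elim/big_rec2: _ => [|i a b _ <-]; rewrite ?ip0r// ipDr.
rewrite ip_sum lt_neqAle sumr_ge0 ?andbT//.
apply/eqP => /esym/eqP; rewrite psumr_eq0// => /allP ip0.
have ipe (i : 'I_(\dim {:V})) : ip y e`_i = 0.
  have [K1 K2 ->] := pP i; move: (ip0 i); rewrite mem_index_enum => /(_ isT)/eqP.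
  rewrite !ipE; move: (cone_ip_ge0 Ky K1) (cone_ip_ge0 Ky K2); lra.
have := ip_gt0 ip y0.
rewrite {2}(coord_basis (vbasisP {:V}) (memvf y)) ip_sum big1 ?ltxx// => i _.
by rewrite ipZr ipe mulr0.
Qed.

(** [p] is the point of [K] nearest to [x] and [q = p - x]; minimality gives both [K q] and
    orthogonality. *)
Lemma moreau x : exists p q, [/\ K p, K q, x = p - q & ip p q = 0].
Proof.
(* The ball contains [0], so [S] is nonempty, and points of [K] outside it are farther from [x] than
   [0] is. *)
pose S := K `&` [set y | `|x - y| <= `|x|].
have distc : continuous (fun y => `|x - y|).
  by move=> y; apply: cvg_norm; apply: cvgB; [exact: cvg_cst|exact: cvg_id].
have S_closed : closed S.
  apply: closedI => //.
  apply: (@preimage_closed _ _ (fun y : V => `|x - y|) [set t | t <= `|x|]).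
    by move=> y _; exact: distc.
  exact: closed_le.
have S_compact : compact S.
  apply: (closed_bounded_compact euc S_closed (M := `|x| + `|x|)) => y [_ /= xy].
  by rewrite -[y](subKr x) (le_trans (ler_normB _ _))// lerD2l.
have [|p /set_mem[Kp xp] pmin] := compact_EVT_min _ S_compact
    (@continuous_subspaceT _ _ S _ distc).
  by exists 0; split; [exact: cone0|rewrite /= subr0].
have {}pmin y : K y -> ip (x - p) (x - p) <= ip (x - y) (x - y).
  move=> Ky; rewrite -!(sqr_normE euc) ler_sqr ?nnegrE//.
  have [xy|/ltW xy] := leP `|x - y| `|x|.
    by apply: pmin; apply/mem_set; split.
  exact: le_trans xy.
(* moving from [p] inside [K] along [w] increases the distance to [x] *)
have first_order w : (forall t, 0 < t <= 1 -> K (p + t *: w)) ->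
    0 <= ip w (p - x).
  move=> Kw; rewrite leNgt; apply/negP => w_lt0.
  pose a := ip w w; pose b := ip w (p - x).
  have a0 : 0 <= a by rewrite /a -(sqr_normE euc) sqr_ge0.
  have t_step t : 0 < t <= 1 -> 0 <= 2 * b + t * a.
    move=> /[dup] t01 /andP[t0 _]; have := pmin _ (Kw t t01).
    rewrite -subr_ge0 -[in X in _ -> X](pmulr_rge0 _ t0).
    suff -> : ip (x - (p + t *: w)) (x - (p + t *: w)) - ip (x - p) (x - p) =
      t * (2 * b + t * a) by [].
    by rewrite /a /b !ipE (ipC _ x w) (ipC _ p w) (ipC _ p x); ring.
  (* As [b < 0], this [t] lies in []0, 1]] and [t * a < - b], so [2 * b + t * a < b < 0]. *)
  pose t := - b / (a - b).
  have ab : 0 < a - b by rewrite subr_gt0 (lt_le_trans w_lt0).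
  have t01 : 0 < t <= 1.
    rewrite divr_gt0 ?oppr_gt0//= /t ler_pdivrMr// mul1r; lra.
  have := t_step _ t01; apply/negP; rewrite -ltNge.
  have : t * a < - b.
    rewrite /t mulrAC ltr_pdivrMr// ltr_pM2l ?oppr_gt0//.
    by rewrite ltrBrDl gtrDr.
  by move: w_lt0; rewrite -/b; lra.
exists p, (p - x); split=> //; last 2 first.
- by rewrite subKr.
(* Both directions [p] and [- p] are admissible, since [p - t *: p] stays in [K] for [t <= 1]. *)
- apply/le_anti/andP; split; last first.
    by apply: first_order => t /andP[/ltW t0 _]; apply: coneD => //; exact: coneZ.
  rewrite -oppr_ge0 -ipNl; apply: first_order => t /andP[_ t1].
  rewrite -[X in X + _]scale1r scalerN -scalerBl.
  by apply: coneZ => //; rewrite subr_ge0.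
apply/self_dualP => y Ky; apply: first_order => t /andP[/ltW t0 _].
by apply: coneD => //; exact: coneZ.
Qed.

End SelfDualCone.

(** * Negativity of self-adjoint quasi-monotone maps *)

Section QuasiMonotone.
Context {R : realType} {V : normedVectType R} (ip : {dot V for idfun}).
Variable K : set V.
Hypotheses (euc : euclidean ip) (K_closed : closed K) (K_sd : self_dual ip K).
Implicit Types (x y z u v : V) (A T : 'End(V)).

(** First-order condition at a maximum, tested at [t = b / c] with [c] large enough that
    [2 * c + a > 0]. *)
Lemma linear_term_eq0 (a b : R) :
  (forall t, 2 * t * b + t ^+ 2 * a <= 0) -> b = 0.
Proof.
pose c := `|a| + 1 => /(_ (b / c)) quad_le0.
have c0 : 0 < c by rewrite ltr_wpDl.
have ca : 0 < 2 * c + a.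
  by have := ler_norm (- a); rewrite normrN /c; have := normr_ge0 a; lra.
have : b ^+ 2 * (2 * c + a) <= 0.
  rewrite (_ : b ^+ 2 * _ = c ^+ 2 * (2 * (b / c) * b + (b / c) ^+ 2 * a)).
    by rewrite pmulr_rle0// exprn_gt0.
  by field; rewrite gt_eqF.
rewrite pmulr_lle0// => b2_le0; apply/eqP; rewrite -sqrf_eq0.
by rewrite eq_le b2_le0 sqr_ge0.
Qed.

(* The maximum [l] of the Rayleigh quotient over [K] is its maximum over [V],
   because a quasi-monotone form only grows when the cross term of the Moreau
   decomposition is dropped.  So [l] is an eigenvalue with an eigenvector [u]
   in [K], and pairing [T u = l u] with [v] gives [l < 0]. *)
Lemma quasi_monotone_lt0 T v : self_adjoint ip T -> quasi_monotone ip K T ->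
  interior K v -> interior K (- T v) -> forall x, x != 0 -> ip x (T x) < 0.
Proof.
move=> /self_adjointP Tsa Tqm /(interior_coneP euc K_closed K_sd) vK.
move=> /(interior_coneP euc K_closed K_sd) TvK x x0.
have Kn0 : exists2 y, K y & y != 0.
  have [p [q [Kp Kq xpq _]]] := moreau euc K_closed K_sd x.
  have [p0|] := eqVneq p 0; last by exists p.
  by exists q => //; move: x0; rewrite xpq p0 sub0r oppr_eq0.
have fc : continuous (fun y => - ip y (T y)).
  move=> y; apply: cvgN; move: y.
  apply: (continuous_ip euc (f := id) (g := T)).
    by move=> y; exact: cvg_id.
  exact: lfun_continuous euc T.
have [u [Ku u1 umax]] := cone_sphere_min euc K_closed K_sd fc Kn0.
have u0 : u != 0 by rewrite -normr_eq0 u1 oner_eq0.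
have uu : ip u u = 1 by rewrite -(sqr_normE euc) u1 expr1n.
pose l := ip u (T u).
have maxK z : K z -> ip z (T z) <= l * ip z z.
  move=> Kz; have [->|z0] := eqVneq z 0; first by rewrite !ip0l mulr0.
  have nz0 : 0 < `|z| by rewrite normr_gt0.
  have Kz1 : K (`|z|^-1 *: z) by apply: (coneZ K_sd); rewrite ?invr_ge0.
  have z1 : `|(`|z|^-1 *: z)| = 1.
    by rewrite normrZ normfV normr_id mulVf// gt_eqF.
  have := umax _ Kz1 z1; rewrite lerN2 linearZ/= ipZl ipZr -/l.
  by rewrite -(sqr_normE euc) mulrA -invfM -expr2 ler_pdivrMl ?exprn_gt0// mulrC.
(* With [y = p - q], the cross term [- 2 * ip p (T q)] is nonpositive and
   [ip y y = ip p p + ip q q]. *)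
have maxV y : ip y (T y) <= l * ip y y.
  have [p [q [Kp Kq -> pq]]] := moreau euc K_closed K_sd y.
  have := maxK _ Kp; have := maxK _ Kq; have := Tqm _ _ Kp Kq pq.
  rewrite linearB/= !ipE (ipC _ q p) pq -(Tsa q p) (ipC _ (T q) p); lra.
suff l0 : l < 0.
  by apply: le_lt_trans (maxV x) _; rewrite pmulr_llt0// ip_gt0.
(* The eigenvector equation paired with [v]: along [u + t *: v] the form of [T - l] is nonpositive
   and vanishes at [t = 0]. *)
have b0 : ip v (T u) - l * ip v u = 0.
  apply: (@linear_term_eq0 (ip v (T v) - l * ip v v)) => t.
  have := maxV (u + t *: v).
  rewrite linearD linearZ/= !ipE -/l uu (ipC _ u v) -(Tsa u v) (ipC _ (T u) v).
  lra.
have := vK _ Ku u0; have := TvK _ Ku u0.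
rewrite ipNr -Tsa (ipC _ (T u)) (ipC _ u v) => Tuv uv.
by rewrite -(pmulr_llt0 _ uv); move: b0 Tuv; lra.
Qed.

(** * Solving [- A u = c] in the interior of [K] *)

Section StableQuasiMonotone.
Variables (A : 'End(V)) (c : V).
Hypothesis A_noeig : forall (t : R) x, 0 <= t -> A x = t *: x -> x = 0.

Let M (s : R) : 'End(V) := ((1 - s) *: \1 - s *: A)%VF.

Let ME s x : M s x = (1 - s) *: x - s *: A x.
Proof. by rewrite !lfunE/= opp_lfunE !lfunE/= lfunE. Qed.

(** For [s > 0] a kernel vector would be an eigenvector of [A] for [(1 - s) / s >= 0]. *)
Let M_inj (s : R) : `[0, 1]%classic s -> lker (M s) == 0%VS.
Proof.
rewrite /= in_itv/= => /andP[s0 s1]; rewrite -subv0; apply/subvP => x.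
rewrite memv_ker memv0 ME subr_eq0 => /eqP Mx; apply/eqP.
have [s_eq0|sn0] := eqVneq s 0.
  by move: Mx; rewrite s_eq0 subr0 scale1r scale0r.
apply: (@A_noeig ((1 - s) / s)); first by rewrite divr_ge0// subr_ge0.
by rewrite mulrC -scalerA Mx scalerA mulVf// scale1r.
Qed.

Let f (s : R) : V := ((M s)^-1)%VF c.

Let Mf (s : R) : `[0, 1]%classic s -> M s (f s) = c.
Proof. by move=> s01; rewrite /f lker0_lfunVK// M_inj. Qed.

(* The resolvent difference [M r (f s - f r) = (s - r) (1 + A) (f s)] reduces
   continuity at [s] to a bound on the inverse of [M r], uniform for [r] near
   [s]. *)
Let f_continuous : {within `[0, 1], continuous f}.
Proof.
apply/subspace_continuousP => s s01; have sinj := M_inj s01.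
have [C1 C10 C1P] := lfun_bounded euc ((M s)^-1)%VF.
have [C2 C20 C2P] := lfun_bounded euc (\1 + A)%VF.
have small (k e : R) : 0 <= k -> 0 < e ->
    \forall r \near within `[0, 1]%classic (nbhs s), `|r - s| * k <= e.
  move=> k0 e0; apply: cvg_within.
  have k1 : 0 < k + 1 by rewrite ltr_wpDl.
  near=> r; apply: (@le_trans _ _ (e / (k + 1) * (k + 1))); last first.
    by rewrite divfK// gt_eqF.
  apply: ler_pM => //; last by rewrite lerDl.
  rewrite distrC; near: r; apply: cvgr_dist_le; [exact: cvg_id|].
  by rewrite divr_gt0.
apply/cvgrPdist_le => e e0; pose z := (\1 + A)%VF (f s).
(* The factors [2] make the two terms bounding [|f s - f r|] below at most [e / 2] and half of that
   norm itself, which is then absorbed. *)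
have k1 := small (2 * C1 * C2) 1 (mulr_ge0 (mulr_ge0 (ler0n R 2) C10) C20) ltr01.
have k2 := small (2 * C1 * `|z|) e (mulr_ge0 (mulr_ge0 (ler0n R 2) C10) (normr_ge0 _)) e0.
near=> r.
have r01 : `[0, 1]%classic r by near: r; exact: withinT.
have rs1 : `|r - s| * (2 * C1 * C2) <= 1 by near: r.
have rs2 : `|r - s| * (2 * C1 * `|z|) <= e by near: r.
have MB x : M s x = M r x + (r - s) *: (\1 + A)%VF x.
  rewrite !ME add_lfunE id_lfunE scalerDr -!scaleNr addrACA -!scalerDl.
  by congr (_ *: _ + _ *: _); ring.
set x := f s - f r.
have Mrx : M r x = (s - r) *: z.
  rewrite linearB/= (Mf r01) -(Mf s01) (MB (f s)).
  by rewrite opprD addrA subrr sub0r -scaleNr opprB.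
have xle : `|x| <= C1 * (`|r - s| * `|z| + `|r - s| * (C2 * `|x|)).
  rewrite -{1}(lker0_lfunK sinj x) (le_trans (C1P _))// ler_wpM2l// MB.
  rewrite (le_trans (ler_normD _ _))// Mrx !normrZ distrC lerD2l.
  by rewrite ler_wpM2l.
have : `|r - s| * (2 * C1 * C2) * `|x| <= `|x| by rewrite ler_piMl.
by move: xle rs2; lra.
Unshelve. all: by end_near. Qed.

(* Along the path [f s = ((1 - s) - s A)^-1 c] quasi-monotonicity forbids [f s]
   to touch the boundary of [K], so the connected image of [[0, 1]], which
   contains [c], stays in the interior. *)
Lemma quasi_monotone_stable_interior : quasi_monotone ip K A ->
  interior K c -> exists2 u, interior K u & - A u = c.
Proof.
move=> Aqm cK.
(* If [y] in [K] is orthogonal to [f s], then [ip y c = - s * ip y (A (f s)) <= 0], while [c] is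
   interior. *)
have fK s : `[0, 1]%classic s -> K (f s) -> interior K (f s).
  move=> /[dup] s01; rewrite /= in_itv/= => /andP[s0 s1] Kf.
  apply/(interior_coneP euc K_closed K_sd) => y Ky y0.
  rewrite lt_neqAle (cone_ip_ge0 K_sd)// andbT eq_sym; apply/eqP => yf0.
  have := Aqm _ _ Ky Kf yf0.
  move: cK => /(interior_coneP euc K_closed K_sd)/(_ _ Ky y0).
  rewrite -(Mf s01) ME ipE ipNr !ipZr yf0 mulr0 sub0r oppr_gt0 => sA A0.
  by move: sA; rewrite ltNge mulr_ge0.
have zero01 : `[0, 1]%classic (0 : R) by rewrite /= in_itv/= lexx ler01.
have one01 : `[0, 1]%classic (1 : R) by rewrite /= in_itv/= lexx ler01.
have f0 : f 0 = c.
  by have := Mf zero01; rewrite ME subr0 scale1r scale0r subr0.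
have fI : connected (f @` `[0, 1]).
  by apply: connected_continuous_connected; [exact: segment_connected|].
(* The part of the path in [K] is nonempty, relatively closed, and relatively open because it equals
   the part in the interior. *)
have : f @` `[0, 1] `&` K = f @` `[0, 1].
  apply: fI.
  - by exists c; split; [exists 0|exact: interior_subset].
  - exists (interior K); first exact: open_interior.
    rewrite eqEsubset; split=> x [[s s01 <-]].
      by move=> /(fK _ s01) fsK; split=> //; exists s.
    by move=> fsK; split; [exists s|exact: interior_subset].
  - by exists K.
move=> fIK; have [_ Kf1] : (f @` `[0, 1] `&` K) (f 1) by rewrite fIK; exists 1.
exists (f 1); first exact: fK.
by have := Mf one01; rewrite ME subrr scale0r scale1r sub0r.
Qed.

End StableQuasiMonotone.

End QuasiMonotone.

(** * Stability, adjoints and the Lyapunov operator *)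

Section LyapunovOperator.
Import passmx.
Context {R : realType} {V : normedVectType R} (ip : {dot V for idfun}).
Variable K : set V.
Implicit Types (x y : V) (t : R) (A D : 'End(V)).

(** The coordinate row of a real eigenvector is an eigenvector of the complexified matrix for the
    same real value. *)
Lemma stable_noeig_ge0 A t x :
  stable A -> 0 <= t -> A x = t *: x -> x = 0.
Proof.
move=> Ast t0 Ax; apply/eqP; apply: contraT => x0.
have e_basis := vbasisP {:V}.
suff /Ast/= : eigenvalue (map_mx (real_complex R)
    (mxof (vbasis {:V}) (vbasis {:V}) A)) (real_complex R t).
  by rewrite ltNge t0.
apply/eigenvalueP; exists (map_mx (real_complex R) (rVof (vbasis {:V}) x)).
  by rewrite -map_mxM -rVof_app// Ax linearZ/= map_mxZ.
by rewrite map_mx_eq0 rVof_eq0.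
Qed.

(** [A - t] is injective, hence onto in finite dimension, and an eigenvector of the adjoint is
    orthogonal to its range. *)
Lemma adjoint_noeig A t :
  (forall x, A x = t *: x -> x = 0) ->
  forall y, adjoint ip A y = t *: y -> y = 0.
Proof.
move=> A_noeig y Ay; pose N : 'End(V) := (A - t *: \1)%VF.
have NE x : N x = A x - t *: x by rewrite add_lfunE opp_lfunE scale_lfunE id_lfunE.
have N_inj : lker N == 0%VS.
  rewrite -subv0; apply/subvP => x; rewrite memv_ker memv0 NE subr_eq0.
  by move=> /eqP /A_noeig ->.
apply/eqP; apply: contraT => /(ip_gt0 ip).
rewrite -{2}(lker0_lfunVK N_inj y) NE ipDr ipNr adjointPr Ay ipZl ipZr.
by rewrite subrr ltxx.
Qed.

Lemma quasi_monotone_adjoint A :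
  quasi_monotone ip K A -> quasi_monotone ip K (adjoint ip A).
Proof. by move=> Aqm x y Kx Ky xy; rewrite -adjointP ipC Aqm// ipC. Qed.

Lemma self_adjoint_lyapunov A D : self_adjoint ip D ->
  self_adjoint ip ((adjoint ip A \o D) + (D \o A))%VF.
Proof.
move=> /self_adjointP Dsa; apply/self_adjointP => x y.
rewrite !add_lfunE !comp_lfunE ipDl ipDr.
by rewrite -adjointPr Dsa -adjointP Dsa addrC.
Qed.

(** The form splits as [ip (D y) (A x) + ip (D x) (A y)]; diffusivity makes [D y, x] and [D x, y]
    orthogonal pairs in [K], to which quasi-monotonicity of [A] applies. *)
Lemma quasi_monotone_lyapunov A D :
  self_adjoint ip D -> diffusive ip K D -> quasi_monotone ip K A ->
  quasi_monotone ip K ((adjoint ip A \o D) + (D \o A))%VF.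
Proof.
move=> /self_adjointP Dsa [DK D0] Aqm x y Kx Ky xy.
rewrite add_lfunE !comp_lfunE ipDr -adjointP -(Dsa x) (ipC _ (A x)).
have KD z : K z -> K (D z) by move=> Kz; apply: DK; exists z.
apply: addr_ge0; apply: Aqm => //; try exact: KD.
  by rewrite Dsa D0// ipC.
by rewrite Dsa D0.
Qed.

End LyapunovOperator.

Theorem proposition3p7 (R : realType) (V : normedVectType R)
    (ip : {dot V for idfun}) (K : set V) (A : 'End(V)) :
  euclidean ip ->
  proper_cone K ->
  self_dual ip K ->
  (forall v w : V, interior K v -> interior K w ->
     exists D : 'End(V),
       [/\ self_adjoint ip D, diffusive ip K D & D v = w]) ->
  quasi_monotone ip K A ->
  stable A ->
  exists D : 'End(V),
    [/\ self_adjoint ip D, posdef ip D, diffusive ip K D &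
        negdef ip ((adjoint ip A \o D) + (D \o A))%VF].
Proof.
move=> euc [_ K_closed _ K_gen] K_sd K_hom Aqm Ast.
have A_noeig (t : R) (x : V) : 0 <= t -> A x = t *: x -> x = 0.
  exact: stable_noeig_ge0.
have As_noeig (t : R) (x : V) : 0 <= t -> adjoint ip A x = t *: x -> x = 0.
  by move=> t0; apply: adjoint_noeig => y; exact: A_noeig.
have [c cK] := interior_cone_neq0 euc K_closed K_sd K_gen.
have [v vK Av] :=
  quasi_monotone_stable_interior euc K_closed K_sd A_noeig Aqm cK.
have [w wK Aw] := quasi_monotone_stable_interior euc K_closed K_sd As_noeig
  (quasi_monotone_adjoint Aqm) cK.
have [D [Dsa Ddiff Dv]] := K_hom v w vK wK.
have DsaE := (self_adjointP ip D).1 Dsa.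
exists D; split=> //; split=> //.
- move=> x x0; rewrite -oppr_lt0 -ipNr -opp_lfunE.
  apply: (quasi_monotone_lt0 euc K_closed K_sd _ _ vK) => //.
  + by apply/self_adjointP => y z; rewrite !opp_lfunE ipNl ipNr DsaE.
  + by move=> y z Ky Kz yz; rewrite opp_lfunE ipNr Ddiff.2// oppr0.
  + by rewrite opp_lfunE opprK Dv.
- exact: self_adjoint_lyapunov.
- apply: (quasi_monotone_lt0 euc K_closed K_sd _ _ vK).
  + exact: self_adjoint_lyapunov.
  + exact: quasi_monotone_lyapunov.
  (* The opposite of the image of [v] is [c + D c], an interior point plus a point of [K]. *)
  + rewrite add_lfunE !comp_lfunE Dv opprD Aw -linearN/= Av.
    apply: (interior_coneD euc K_closed K_sd) => //.
    by apply: Ddiff.1; exists c => //; exact: interior_subset.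
Qed.
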